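(* Let $u_h\in V_h$ be a continuous first-order finite element approximation of $u\in P_1(\Omega)$ (so that $u_h\in P_1(\Omega)$). Then the stabilized semi-discrete problem $\mathsf M(u_h)\,\mathrm d_tu_h+\mathsf K(u_h)u_h=g$ and the discrete problem $\mathsf M(u_h^{n+1})\delta_tu_h^{n+1}+\mathsf K(u_h^{n+1})u_h^{n+1}=g^{n+1}$ are linearity preserving, in the sense that the Galerkin problem and the stabilized one are identical, i.e. $\nu_{ij}(u_h)=0$ (hence $\mathsf K(u_h)=\mathsf F(u_h)$) and $\mathsf M_{ij}(u_h)=(\varphi_j,\varphi_i)$ for all $i,j\in\mathcal N_h$.
   Context: $\Omega\subset\mathbb R^d$ is a bounded domain and $\mathcal T_h$ a conforming mesh of $\Omega$ (triangles/quadrilaterals for $d=2$, tetrahedra/hexahedra for $d=3$) with set of nodes $\mathcal N_h$; node $i$ has position $\boldsymbol x_i$. $\Omega_i$ is the union of the elements having $i$ as a node, and $\mathcal N_h(\Omega_i)$ is the set of nodes in $\Omega_i$ (including $i$). $V_h$ is the continuous $P_1$ (or $Q_1$ on quadrilaterals/hexahedra) finite element space with nodal basis $\{\varphi_i\}$, and $u_h=\sum_i u_i\varphi_i$; both problems are posed in the dual space $V_h'$. $P_1(\Omega)$ is the space of polynomials of total degree at most $1$. $(\cdot,\cdot)$ is the $L^2(\Omega)$ inner product, $\boldsymbol f\in\mathrm{Lip}(\mathbb R;\mathbb R^d)$ the flux of the conservation law $\partial_tu+\nabla\cdot\boldsymbol f(u)=g$, $\mathsf F_{ij}(w_h)=(\boldsymbol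 f'(w_h)\cdot\nabla\varphi_j,\varphi_i)$. The Galerkin problem has mass matrix $(\varphi_j,\varphi_i)$ and operator $\mathsf F$. Shock detector: for $j\in\mathcal N_h(\Omega_i)\setminus\{i\}$ let $\boldsymbol r_{ij}=\boldsymbol x_j-\boldsymbol x_i$; let $\boldsymbol x_{ij}^{\rm sym}$ be the point at the intersection between the line that passes through $\boldsymbol x_i$ and $\boldsymbol x_j$ and $\partial\Omega_i$ that is not $\boldsymbol x_j$; $\boldsymbol r_{ij}^{\rm sym}=\boldsymbol x_{ij}^{\rm sym}-\boldsymbol x_i$, $u_j^{\rm sym}=u_h(\boldsymbol x_{ij}^{\rm sym})$. Set $$J_{ij}=\frac{u_j-u_i}{|\boldsymbol r_{ij}|}+\frac{u_j^{\rm sym}-u_i}{|\boldsymbol r_{ij}^{\rm sym}|},\qquad A_{ij}=\frac12\Big(\frac{|u_j-u_i|}{|\boldsymbol r_{ij}|}+\frac{|u_j^{\rm sym}-u_i|}{|\boldsymbol r_{ij}^{\rm sym}|}\Big),$$ and, with sums over $j\in\mathcal N_h(\Omega_i)\setminus\{i\}$ and some $q\in\mathbb R^+$, $$\alpha_i(u_h)=\Big[\frac{|\sum_j J_{ij}|}{\sum_j 2A_{ij}}\Big]^q\ \text{ if }\sum_jA_{ij}\neq0,\qquad \alpha_i(u_h)=0\ \text{ otherwise.}$$ Stabilization: $\nu_{ij}(w_h)=\max\{\alpha_i(w_h)\mathsf F_{ij}(w_h),\alpha_j(w_h)\mathsf F_{ji}(w_h),0\}$ for $i\ne j$, $\nu_{ii}=\sum_{j\in\mathcal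 N_h(\Omega_i),j\ne i}\nu_{ij}$; $\mathsf B_{ij}(w_h)=\nu_{ij}(w_h)(2\delta_{ij}-1)$ for $j\in\mathcal N_h(\Omega_i)$ and $0$ otherwise; $\mathsf K=\mathsf F+\mathsf B$. Mass matrix: $\mathsf M_{ij}(w_h)=(1-\alpha_i(w_h))(\varphi_j,\varphi_i)+\alpha_i(w_h)(\delta_{ij},\varphi_i)$. Backward Euler: $\delta_tu_h^{n+1}=(u_h^{n+1}-u_h^n)/\Delta t_{n+1}$, $\Delta t_{n+1}=t^{n+1}-t^n$.
   Formalization: At nodes on the boundary (or wherever the symmetric point is not unique or equals x_i) J_ij and A_ij are undefined; pairs with no well-defined symmetric point different from x_i are left out of the sums defining alpha_i, so alpha_i = 0 at boundary nodes. *)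

(* Defs.v *)
From HB Require Import structures.
From mathcomp Require Import all_boot all_order all_algebra.
From mathcomp Require Import all_classical all_reals all_analysis.
Import Order.TTheory GRing.Theory Num.Theory.
Import numFieldNormedType.Exports.
Set Implicit Arguments.
Unset Strict Implicit.
Unset Printing Implicit Defensive.
Local Open Scope classical_set_scope.
Local Open Scope ring_scope.

(* The library has the sigma-algebra of [n.-tuple T] but no product measure on
   it: iterate the binary product along T * n.-tuple T ~ n.+1.-tuple T. *)
Section TuplePower.
Context dT (T : measurableType dT) (R : realType).

Definition tcons n (p : T * n.-tuple T) : n.+1.-tuple T :=
  [the n.+1.-tuple T of p.1 :: p.2].

Lemma measurable_tcons n : measurable_fun setT (@tcons n).
Proof. exact: measurable_cons measurable_fst measurable_snd. Qed.

Section Step.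
Variables (n : nat) (mu : {sigma_finite_measure set T -> \bar R}).
Variable (m : {sigma_finite_measure set (n.-tuple T) -> \bar R}).

Definition tuple_step : set (n.+1.-tuple T) -> \bar R :=
  pushforward (product_measure1 mu m) (@tcons n).

Let tuple_step0 : tuple_step set0 = 0%E.
Proof. by rewrite /tuple_step /pushforward preimage_set0 measure0. Qed.

Let tuple_step_ge0 A : (0 <= tuple_step A)%E.
Proof. by rewrite /tuple_step /pushforward; exact: measure_ge0. Qed.

Let tuple_step_sigma_additive : semi_sigma_additive tuple_step.
Proof.
have mtc A : measurable A -> measurable (@tcons n @^-1` A).
  by move=> mA; rewrite -[X in measurable X]setTI; exact: measurable_tcons.
move=> F mF tF mUF; rewrite /tuple_step /pushforward preimage_bigcup.
apply: measure_semi_sigma_additive.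
- by move=> k; exact: mtc.
- apply/trivIsetP => /= i j _ _ ij; rewrite -preimage_setI.
  by move/trivIsetP : tF => /(_ _ _ _ _ ij) ->//; rewrite preimage_set0.
- by rewrite -preimage_bigcup; exact: mtc.
Qed.

HB.instance Definition _ := isMeasure.Build _ _ _ tuple_step
  tuple_step0 tuple_step_ge0 tuple_step_sigma_additive.

Lemma tuple_step_sigma_finite : sigma_finite setT tuple_step.
Proof.
have /sigma_finiteP[F [FT ndF mF]] := sigma_finiteT mu.
have /sigma_finiteP[G [GT ndG mG]] := sigma_finiteT m.
pose g (t : n.+1.-tuple T) : T * n.-tuple T := (tnth t ord0, [tuple of behead t]).
have mg : measurable_fun setT g.
  apply: measurable_fun_pair; first exact: measurable_tnth.
  exact: measurable_behead.
have gK : cancel (@tcons n) g.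
  by move=> [x t]; rewrite /g /tcons/=; congr (_, _); apply: val_inj.
exists (fun k => g @^-1` (F k `*` G k)) => [|k].
  rewrite -preimage_bigcup; apply/seteqP; split=> // t _ /=.
  have [i _ Fi] : (\bigcup_i F i) (g t).1 by rewrite -FT.
  have [j _ Gj] : (\bigcup_i G i) (g t).2 by rewrite -GT.
  exists (maxn i j) => //=; split.
  - by move: Fi; exact/subsetPset/ndF/leq_maxl.
  - by move: Gj; exact/subsetPset/ndG/leq_maxr.
have [mFk Fk] := mF k; have [mGk Gk] := mG k; split.
  by rewrite -[X in measurable X]setTI; apply: mg => //; exact: measurableX.
rewrite /tuple_step /pushforward -comp_preimage.
have -> : (g \o @tcons n) @^-1` (F k `*` G k) = F k `*` G k.
  by apply/funext => p; rewrite /preimage/= -[in RHS](gK p).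
by rewrite product_measure1E// lte_mul_pinfty// ge0_fin_numE.
Qed.

HB.instance Definition _ := @Measure_isSigmaFinite.Build _ _ _ 
  tuple_step tuple_step_sigma_finite.
End Step.

Fixpoint tuple_power (mu : {sigma_finite_measure set T -> \bar R}) n :
    {sigma_finite_measure set (n.-tuple T) -> \bar R} :=
  if n is n'.+1 then tuple_step mu (tuple_power mu n')
  else \d_([tuple] : 0.-tuple T).

End TuplePower.

Section Euclidean.
Context (R : realType) (d : nat).
Implicit Types (x y : 'rV[R]_d) (A Omega : set 'rV[R]_d) (f : 'rV[R]_d -> R).

(* The normed-module norm of ['rV_d] is the sup norm; the topology is the same. *)
Definition enorm x : R := Num.sqrt (\sum_k x 0 k ^+ 2).

Definition frontier A : set 'rV[R]_d := closure A `\` interior A.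

Definition rv_of_tuple (t : d.-tuple (measurableTypeR R)) : 'rV[R]_d :=
  \row_k tnth t k.

Definition integral_rV Omega f : R :=
  \int[tuple_power (@lebesgue_measure R) d]_(t in rv_of_tuple @^-1` Omega)
    f (rv_of_tuple t).

Definition inner_L2 Omega f g : R := integral_rV Omega (fun x => f x * g x).

Definition partial (k : 'I_d) f x : R := 'D_(delta_mx 0 k : 'rV[R]_d) f x.

Definition in_P1 Omega f : Prop :=
  exists (c : R) (a : 'rV[R]_d),
    forall x, Omega x -> f x = c + \sum_k a 0 k * x 0 k.

Definition bounded_domain Omega : Prop :=
  [/\ Omega !=set0, open Omega, connected Omega & bounded_set Omega].

End Euclidean.

(* Reference elements: the unit simplex with P1 shape functions (triangle,
   tetrahedron) and the unit cube with Q1 shape functions (quadrilateral,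
   hexahedron). *)
Inductive ekind := Simplex | Cube.

Definition vertex (d : nat) (s : ekind) : finType :=
  match s with
  | Simplex => 'I_d.+1
  | Cube => {ffun 'I_d -> bool}
  end.

Definition ref_elem (R : realType) d (s : ekind) : set 'rV[R]_d :=
  match s with
  | Simplex => [set xi | (forall k, 0 <= xi 0 k) /\ \sum_k xi 0 k <= 1]
  | Cube => [set xi | forall k, 0 <= xi 0 k <= 1]
  end.

Definition shape_fun (R : realType) d (s : ekind) :
    vertex d s -> 'rV[R]_d -> R :=
  match s with
  | Simplex => fun v xi =>
      if unlift ord0 v is Some k then xi 0 k else 1 - \sum_k xi 0 k
  | Cube => fun v xi => \prod_k (if v k then xi 0 k else 1 - xi 0 k)
  end.

(* The vertex sets of the (possibly empty) faces of the reference element: any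
   set of vertices of the simplex, and for the cube the sets obtained by
   prescribing some of the coordinates. *)
Definition is_face d (s : ekind) : set (vertex d s) -> Prop :=
  match s with
  | Simplex => fun=> True
  | Cube => fun A => A = set0 \/
      exists a : 'I_d -> option bool,
        A = [set v | forall k b, a k = Some b -> v k = b]
  end.

Definition ref_face (R : realType) d (s : ekind) (A : set (vertex d s)) :
    set 'rV[R]_d :=
  [set xi | @ref_elem R d s xi /\ forall v, ~ A v -> shape_fun v xi = 0].

Record mesh (R : realType) (d : nat) := Mesh {
  nnodes : nat;
  node_pos : 'I_nnodes -> 'rV[R]_d;
  cell : finType;
  cell_kind : cell -> ekind;
  cell_node : forall K : cell, vertex d (cell_kind K) -> 'I_nnodes
}.

Section FiniteElements.
Context (R : realType) (d : nat) (T : mesh R d).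
Implicit Types (K L : cell T) (i j : 'I_(nnodes T)) (x xi : 'rV[R]_d).
Implicit Types (u w : 'cV[R]_(nnodes T)) (Omega : set 'rV[R]_d).

Definition cell_map K xi : 'rV[R]_d :=
  \sum_(v : vertex d (cell_kind K)) shape_fun v xi *: node_pos (cell_node v).

Definition cell_ref K : set 'rV[R]_d := @ref_elem R d (cell_kind K).

Definition elem K : set 'rV[R]_d := cell_map K @` cell_ref K.

Definition node_of i K : Prop := exists v, @cell_node R d T K v = i.

Definition shared K L : set (vertex d (cell_kind K)) :=
  [set v | node_of (cell_node v) L].
Arguments shared : clear implicits.

(* Nodal coordinate of the point [cell_map K xi] with respect to node [i]. *)
Definition nodal_coord K i xi : R :=
  \sum_(v : vertex d (cell_kind K) | cell_node v == i) shape_fun v xi.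

(* [mesh_faces]: two distinct elements meet in a common proper face (or not at
   all).  [mesh_glue]: they also induce the same parametrization of it, which
   for nonplanar Q1 faces is part of conformity; this makes the nodal basis
   single-valued and continuous. *)
Record conforming_mesh_of Omega : Prop := ConformingMesh {
  mesh_cover : \bigcup_K elem K = closure Omega;
  mesh_node_inj : injective (@node_pos R d T);
  mesh_node_cell : forall i, exists K, node_of i K;
  mesh_cell_node_inj : forall K, injective (@cell_node R d T K);
  mesh_cell_inj : forall K, {in cell_ref K &, injective (cell_map K)};
  mesh_faces : forall K L, K != L ->
    [/\ is_face (shared K L), shared K L <> setT &
        elem K `&` elem L = cell_map K @` ref_face (shared K L)];
  mesh_glue : forall K L xi eta, cell_ref K xi -> cell_ref L eta ->
    cell_map K xi = cell_map L eta ->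
    forall i, nodal_coord K i xi = nodal_coord L i eta
}.

(* Nodal basis function, extended by 0 outside the union of the elements. *)
Definition phi i x : R :=
  xget 0 [set c | exists K xi,
    [/\ cell_ref K xi, cell_map K xi = x & c = nodal_coord K i xi]].

(* The element of V_h with nodal values [u]. *)
Definition fe_fun u x : R := \sum_i u i 0 * phi i x.

(* The patch Omega_i. *)
Definition macro_elem i : set 'rV[R]_d :=
  \bigcup_(K in [set K | node_of i K]) elem K.

Definition nbr i j : bool := (j != i) && `[< macro_elem i (node_pos j) >].

(* Symmetric point: the line through x_i and x_j meets the boundary of the
   patch, apart from x_j, in exactly the point [xsym i j].  The quotients below
   make sense when this point exists and differs from x_i ([sym_defined]). *)
Definition sym_locus i j : set 'rV[R]_d :=
  [set y | (exists t : R, y = node_pos i + t *: (node_pos j - node_pos i)) /\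
           frontier (macro_elem i) y /\ y <> node_pos j].

Definition sym_defined i j : bool :=
  `[< exists2 y, sym_locus i j = [set y] & y <> node_pos i >].

Definition xsym i j : 'rV[R]_d := xget (node_pos i) (sym_locus i j).

Definition usym w i j : R := fe_fun w (xsym i j).

Definition detJ w i j : R :=
  (w j 0 - w i 0) / enorm (node_pos j - node_pos i) +
  (usym w i j - w i 0) / enorm (xsym i j - node_pos i).

Definition detA w i j : R :=
  2^-1 * (`|w j 0 - w i 0| / enorm (node_pos j - node_pos i) +
          `|usym w i j - w i 0| / enorm (xsym i j - node_pos i)).

(* At a node x_i on the boundary of Omega, x_i itself lies on the boundary of
   its patch, so no pair (i, j) has a symmetric point with a nonzero r_ij^sym
   and J_ij, A_ij have no meaning: such pairs do not contribute to the sums. *)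
Definition det_nbr i j : bool := nbr i j && sym_defined i j.

Definition alpha (q : R) w i : R :=
  if \sum_(j | det_nbr i j) detA w i j != 0 then
    (`|\sum_(j | det_nbr i j) detJ w i j| /
      \sum_(j | det_nbr i j) (2 * detA w i j)) `^ q
  else 0.

Section Scheme.
Context (Omega : set 'rV[R]_d) (f : R -> 'rV[R]_d) (q : R).

Definition massG : 'M[R]_(nnodes T) :=
  \matrix_(i, j) inner_L2 Omega (phi j) (phi i).

Definition matF w : 'M[R]_(nnodes T) :=
  \matrix_(i, j) inner_L2 Omega
    (fun x => \sum_k derive1 f (fe_fun w x) 0 k * partial k (phi j) x) (phi i).

Definition nu_off w i j : R :=
  Num.max (Num.max (alpha q w i * matF w i j) (alpha q w j * matF w j i)) 0.

Definition nu w i j : R :=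
  if i == j then \sum_(k | nbr i k) nu_off w i k else nu_off w i j.

Definition matB w : 'M[R]_(nnodes T) :=
  \matrix_(i, j) (if `[< macro_elem i (node_pos j) >]
                  then nu w i j * (2 * (i == j)%:R - 1) else 0).

Definition matK w : 'M[R]_(nnodes T) := matF w + matB w.

Definition matM w : 'M[R]_(nnodes T) :=
  \matrix_(i, j) ((1 - alpha q w i) * inner_L2 Omega (phi j) (phi i) +
                  alpha q w i * inner_L2 Omega (fun=> (i == j)%:R) (phi i)).

End Scheme.

(* Problems in V_h': a functional on V_h is given by its values on the nodal
   basis, [mass] and [op] are the solution-dependent matrices. *)
Definition semi_discrete (mass op : 'cV[R]_(nnodes T) -> 'M[R]_(nnodes T))
    (g v : R -> 'cV[R]_(nnodes T)) (t : R) : Prop :=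
  (forall i, derivable (fun s => v s i 0) t 1) /\
  mass (v t) *m (\col_i derive1 (fun s => v s i 0) t) + op (v t) *m v t = g t.

Definition backward_euler (mass op : 'cV[R]_(nnodes T) -> 'M[R]_(nnodes T))
    (tn tn1 : R) (g1 un un1 : 'cV[R]_(nnodes T)) : Prop :=
  mass un1 *m ((tn1 - tn)^-1 *: (un1 - un)) + op un1 *m un1 = g1.

End FiniteElements.

(* Main.v *)
Require Import Defs.
From mathcomp Require Import all_boot all_order all_algebra.
From mathcomp Require Import all_classical all_reals all_analysis.
From mathcomp Require Import ring.
Import Order.TTheory GRing.Theory Num.Theory.
Import numFieldNormedType.Exports.
Local Open Scope classical_set_scope.
Local Open Scope ring_scope.

(** The stabilization acts only through the shock detector, so everything follows
    from [alpha q u i = 0] at every node ([alpha_affine]): then the artificial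
    viscosity is [max 0 0 0 = 0] and the blended mass matrix is the consistent
    one, so that the stabilized and the Galerkin problems coincide term by term.

    The detector vanishes because each [detJ u i j] is the sum of the slopes of
    [u_h] from [x_i] towards [x_j] and towards the symmetric point, and these two
    slopes are opposite when [u_h] is affine and the two points lie on opposite
    sides of [x_i] ([detJ_affine]). Two facts about the mesh are behind this.
    - The symmetric point is on the other side of [x_i] than [x_j]
      ([xsym_opposite]), because the ray leaving [x_i] away from [x_j] must exit
      the compact patch through its frontier ([ray_meets_frontier]) and the
      symmetric point is the only frontier point available on the line.
    - [u_h] is affine on the closure of the domain, where nodes and symmetric
      points may lie ([affine_closure]), and its value at a node is the nodal
      coefficient ([fe_fun_node]). Both come from the expression of [u_h] on an
      element through the shape functions ([fe_fun_cell_map]). *)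

(** * Rays and bounded closed sets *)

(** The half-line of parameters is connected: if the ray met no frontier point,
    the parameters of its points in [P] would form a set both open and closed in
    the half-line, hence all of it, although [P] is bounded. *)
Lemma ray_meets_frontier (R : realType) (d : nat) (P : set 'rV[R]_d)
    (p r : 'rV[R]_d) : closed P -> bounded_set P -> P p -> r != 0 ->
  exists2 t : R, 0 <= t & frontier P (p + t *: r).
Proof.
move=> cP [M [_ bP]] Pp r0; apply: contrapT => noexit.
pose g (t : R) := p + t *: r.
have cg : continuous g.
  by move=> t; apply: cvgD; [exact: cvg_cst|apply: cvgZr_tmp; exact: cvg_id].
have conn : connected [set t : R | 0 <= t].
  by apply/connected_intervalP => x y /= x0 y0 z /andP[xz _]; exact: le_trans xz.
have inP t : 0 <= t -> P (g t) -> P° (g t).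
  move=> t0 Pg; apply: contrapT => nI; apply: noexit; exists t => //.
  by split=> //; exact: subset_closure.
have allP : [set t | 0 <= t /\ P (g t)] = [set t | 0 <= t].
  apply: conn.
  - by exists 0; split=> //; rewrite /g scale0r addr0.
  - exists (g @^-1` P°); first by apply: open_comp => //; exact: open_interior.
    apply/seteqP; split=> t [t0 Pt]; split=> //; first exact: inP.
    exact: interior_subset.
  - exists (g @^-1` P) => //; exact: closed_comp.
have nr0 : 0 < `|r| by rewrite normr_gt0.
(* A parameter so large that the point of the ray has norm above [M]. *)
set s := (`|M| + 1 + `|p|) / `|r|.
have s0 : 0 <= s by rewrite divr_ge0.
have [_ Ps] : 0 <= s /\ P (g s) by rewrite -/([set t | 0 <= t /\ P (g t)] s) allP.
have /(_ _ _ Ps) := bP (`|M| + 2^-1).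
rewrite (le_lt_trans (ler_norm _)) ?ltrDl// => /(_ isT) /=.
apply/negP; rewrite -ltNge.
have : `|s *: r| - `|p| <= `|g s| by rewrite /g [p + _]addrC lerB_normD.
apply: lt_le_trans; rewrite normrZ ger0_norm// divfK ?gt_eqF// addrK ltrD2l.
by rewrite invf_lt1// ltr1n.
Qed.

(** * Reference elements and cell maps *)

Lemma sum_coord_continuous (R : realType) (d : nat) :
  continuous (fun x : 'rV[R]_d => \sum_k x 0 k).
Proof.
apply: continuous_big => [|k _]; [exact: add_continuous|exact: coord_continuous].
Qed.

Lemma ref_elem_compact (R : realType) (d : nat) (s : ekind) :
  compact (@ref_elem R d s).
Proof.
have cube : compact [set v : 'rV[R]_d | forall i, `[0, 1]%classic (v ord0 i)].
  by apply: (@rV_compact R d (fun=> `[0, 1]%classic)) => i; exact: segment_compact.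
case: s; last exact: cube.
have -> : @ref_elem R d Simplex =
    @ref_elem R d Cube `&` (fun x => \sum_k x 0 k) @^-1` [set y | y <= 1].
  apply/seteqP; split=> x [x0 x1]; split=> // k; last by case/andP: (x0 k).
  by rewrite x0 (le_trans _ x1)// (bigD1 k)//= lerDl sumr_ge0.
apply: compact_closedI => //; apply: closed_comp => [x _|]; last exact: closed_le.
exact: sum_coord_continuous.
Qed.

Lemma shape_fun_continuous (R : realType) (d : nat) (s : ekind) (v : vertex d s) :
  continuous (@shape_fun R d s v).
Proof.
case: s v => v.
- move=> x; rewrite /shape_fun; case: (unlift _ _) => [k|].
    exact: coord_continuous.
  apply: (@cvgB _ _ _ (nbhs (x : 'rV[R]_d))); first exact: cvg_cst.
  exact: sum_coord_continuous.
- apply: continuous_big => [|k _ x]; first exact: mul_continuous.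
  case: (v k); first exact: coord_continuous.
  apply: (@cvgB _ _ _ (nbhs (x : 'rV[R]_d))); first exact: cvg_cst.
  exact: coord_continuous.
Qed.

Lemma cell_map_continuous (R : realType) (d : nat) (T : mesh R d) (K : cell T) :
  continuous (@cell_map R d T K).
Proof.
apply: continuous_big => [|v _ x]; first exact: add_continuous.
apply: (@cvgZr_tmp _ _ _ (nbhs (x : 'rV[R]_d))).
exact: shape_fun_continuous.
Qed.

Lemma elem_compact (R : realType) (d : nat) (T : mesh R d) (K : cell T) :
  compact (@elem R d T K).
Proof.
apply: continuous_compact; last exact: ref_elem_compact.
by apply: continuous_subspaceT; exact: cell_map_continuous.
Qed.

(** The reference vertices: vertex [0] of the simplex is the origin and vertex
    [lift ord0 k] the [k]-th unit vector; a vertex of the cube is its own 0-1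
    coordinate vector. *)
Lemma vertex_dual_point (R : realType) (d : nat) (s : ekind) (v : vertex d s) :
  exists2 xi : 'rV[R]_d, ref_elem s xi &
    forall v', shape_fun v' xi = (v' == v)%:R.
Proof.
case: s v => /= v.
- exists (\row_k (if unlift ord0 v is Some k' then (k == k')%:R else 0)).
    split=> [k|]; first by rewrite mxE; case: unlift.
    under eq_bigr do rewrite mxE.
    case: unliftP => [k' _|_]; last by rewrite big1.
    by rewrite (bigD1 k')//= eqxx big1 ?addr0// => k /negPf ->.
  move=> v'; case: unliftP => [k ->|->]; rewrite ?mxE.
    by case: unliftP => [k' ->|->] //; rewrite ?(inj_eq lift_inj).
  under eq_bigr do rewrite mxE.
  case: unliftP => [k' ->|->]; last by rewrite big1// subr0.
  by rewrite (bigD1 k')//= eqxx big1 ?addr0 ?subrr// => k /negPf ->.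
- exists (\row_k (v k)%:R) => [k|v']; first by rewrite mxE; case: (v k); rewrite ?lexx ?ler01.
  have [->|/eqP neq] := eqVneq v' v.
    by rewrite big1// => k _; rewrite mxE; case: (v k); rewrite ?subr0.
  (* A coordinate on which the two vertices differ gives a zero factor. *)
  have [k vk] : exists k, v' k != v k.
    apply: contrapT => nk; apply: neq; apply/ffunP => k; apply/eqP.
    by apply: contrapT => /negP vk; apply: nk; exists k.
  rewrite (bigD1 k)//= mxE; move: vk.
  by case: (v' k) (v k) => [] []; rewrite ?subrr ?mul0r.
Qed.

(** * The shock detector on a conforming mesh *)

Lemma enormZ (R : realType) (d : nat) (c : R) (x : 'rV[R]_d) :
  enorm (c *: x) = `|c| * enorm x.
Proof.
rewrite /enorm; under eq_bigr do rewrite mxE exprMn.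
by rewrite -big_distrr/= sqrtrM ?sqr_ge0// sqrtr_sqr.
Qed.

Section Mesh.
Context {R : realType} {d : nat} {T : mesh R d} {Omega : set 'rV[R]_d}
  (hT : conforming_mesh_of T Omega).
Implicit Types (i j : 'I_(nnodes T)) (u : 'cV[R]_(nnodes T)).

(** [phi] picks an arbitrary preimage of the point in an arbitrary element; the
    gluing axiom of the mesh says that the choice does not matter. *)
Lemma fe_fun_cell_map u (K : cell T) xi : cell_ref K xi ->
  fe_fun u (cell_map K xi) =
  \sum_(v : vertex d (cell_kind K)) u (cell_node v) 0 * shape_fun v xi.
Proof.
move=> Kxi; rewrite /fe_fun.
have phiE i : phi i (cell_map K xi) = nodal_coord K i xi.
  rewrite /phi; case: xgetP => [c -> [L [eta [Leta eqx ->]]]|/(_ (nodal_coord K i xi)) []].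
    exact: (mesh_glue hT).
  by exists K, xi.
under eq_bigr do rewrite phiE /nodal_coord big_distrr/=.
rewrite (exchange_big_dep predT)//=; apply: eq_bigr => v _.
by under eq_bigl do rewrite eq_sym; rewrite big_pred1_eq.
Qed.

Lemma cell_vertex (K : cell T) (v : vertex d (cell_kind K)) :
  exists2 xi, cell_ref K xi & cell_map K xi = node_pos (cell_node v) /\
    forall u, fe_fun u (cell_map K xi) = u (cell_node v) 0.
Proof.
have [xi Kxi xiE] := vertex_dual_point R d _ v.
exists xi => //; split=> [|u].
  rewrite /cell_map (bigD1 v)//= xiE eqxx scale1r big1 ?addr0// => v' /negPf v'v.
  by rewrite xiE v'v scale0r.
rewrite fe_fun_cell_map// (bigD1 v)//= xiE eqxx mulr1 big1 ?addr0// => v' /negPf v'v.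
by rewrite xiE v'v mulr0.
Qed.

Lemma fe_fun_node u i : fe_fun u (node_pos i) = u i 0.
Proof.
by have [K [v <-]] := mesh_node_cell hT i; have [xi _ [<-]] := cell_vertex _ v.
Qed.

Lemma node_in_macro_elem i : macro_elem i (node_pos i).
Proof.
have [K [v vi]] := mesh_node_cell hT i; exists K; first by exists v.
by have [xi Kxi [xiE _]] := cell_vertex _ v; exists xi; rewrite // xiE vi.
Qed.

Lemma macro_elem_closure i : macro_elem i `<=` closure Omega.
Proof. by move=> x [K _ Kx]; rewrite -(mesh_cover hT); exists K. Qed.

(** Nodes and symmetric points may lie on the boundary of the domain, where the
    affine formula is not part of the hypothesis. On each reference element both
    sides are continuous, so they agree on a compact set; the images of these
    finitely many compact sets form a closed set, which contains [Omega] because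
    the elements cover it. *)
Lemma affine_closure u : in_P1 Omega (fe_fun u) -> in_P1 (closure Omega) (fe_fun u).
Proof.
move=> [c [a uE]]; exists c, a.
pose l (x : 'rV[R]_d) := c + \sum_k a 0 k * x 0 k.
(* Error of the affine formula, pulled back to the reference element. *)
pose e K xi := \sum_(v : vertex d (cell_kind K)) u (cell_node v) 0 * shape_fun v xi
  - l (cell_map K xi).
pose Z K := cell_map K @` (cell_ref K `&` e K @^-1` [set 0]).
have lc : continuous l.
  move=> x; apply: (@cvgD _ _ _ (nbhs (x : 'rV[R]_d))); first exact: cvg_cst.
  apply: continuous_big => [|k _ {}x]; first exact: add_continuous.
  apply: (@cvgM _ _ (nbhs (x : 'rV[R]_d))); [exact: cvg_cst|exact: coord_continuous].
have ec K : continuous (e K).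
  move=> xi; apply: (@cvgB _ _ _ (nbhs (xi : 'rV[R]_d))); last first.
    by apply: (@continuous_comp _ _ _ (cell_map K) l); [exact: cell_map_continuous|exact: lc].
  apply: continuous_big => [|v _ {}xi]; first exact: add_continuous.
  apply: (@cvgM _ _ (nbhs (xi : 'rV[R]_d))); [exact: cvg_cst|exact: shape_fun_continuous].
have Zclosed : closed (\bigcup_K Z K).
  apply: closed_bigcup; first exact: finite_finset.
  move=> K _; apply: compact_closed; first exact: norm_hausdorff.
  apply: continuous_compact.
    by apply: continuous_subspaceT; exact: cell_map_continuous.
  apply: compact_closedI; first exact: ref_elem_compact.
  apply: closed_comp => [xi _|]; [exact: ec|exact: closed_eq].
have OmegaZ : Omega `<=` \bigcup_K Z K.
  move=> x Ox; have := subset_closure Ox; rewrite -(mesh_cover hT) => -[K _ [xi Kxi xE]].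
  exists K => //; exists xi => //; split=> //=.
  by rewrite /e -fe_fun_cell_map// xE uE// subrr.
move=> x /(closure_subset OmegaZ); rewrite -((closure_id _).1 Zclosed).
move=> [K _ [xi [Kxi /= /eqP]]]; rewrite subr_eq0 => /eqP eE <-.
by rewrite fe_fun_cell_map.
Qed.

Lemma macro_elem_compact i : compact (@macro_elem R d T i).
Proof.
rewrite /macro_elem bigcup_fset_set; last exact: finite_finset.
by apply: bigsetU_compact => K _; exact: elem_compact.
Qed.

(** What makes the detector exact on affine functions: [x_i] lies strictly
    between [x_j] and the symmetric point. The definition only says that the line
    through [x_i] and [x_j] meets the frontier of the patch, apart from [x_j], in
    exactly one point, and that this point is not [x_i]. But the ray from [x_i]
    pointing away from [x_j] has to leave the bounded patch through its frontier,
    so the unique point is on that ray. *)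
Lemma xsym_opposite i j : det_nbr i j ->
  frontier (macro_elem i) (xsym i j) /\ exists2 t : R, t < 0 &
    xsym i j = node_pos i + t *: (@node_pos R d T j - node_pos i).
Proof.
case/andP => /andP[ji _] /asboolP [y locus yi].
have Ly : sym_locus i j y by rewrite locus.
have xsymE : xsym i j = y.
  have : sym_locus i j (xsym i j) by apply: xgetPex; exists y.
  by rewrite locus.
have rn0 : node_pos i - node_pos j != 0.
  rewrite subr_eq0; apply/eqP => /(mesh_node_inj hT) ij.
  by rewrite ij eqxx in ji.
have cP := macro_elem_compact i.
have [||s s0 Fs] := @ray_meets_frontier R d (macro_elem i) (node_pos i)
  (node_pos i - node_pos j) _ _ (node_in_macro_elem i) rn0.
- by apply: compact_closed => //; exact: norm_hausdorff.
- exact: compact_bounded.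
have yE : y = node_pos i + (- s) *: (node_pos j - node_pos i).
  suff : sym_locus i j (node_pos i + (- s) *: (node_pos j - node_pos i)).
    by rewrite locus.
  split; first by exists (- s).
  rewrite scaleNr -scalerN opprB; split=> // sj.
  have /eqP : (1 + s) *: (node_pos i - node_pos j) = 0.
    by rewrite scalerDl scale1r addrAC sj subrr.
  by rewrite scaler_eq0 (negPf rn0) orbF gt_eqF// ltr_wpDr.
split=> //; first by rewrite xsymE; case: Ly => _ [].
exists (- s); last by rewrite xsymE.
rewrite oppr_lt0 lt_neqAle s0 andbT; apply/eqP => s00; apply: yi.
by rewrite yE -s00 oppr0 scale0r addr0.
Qed.

(** With [xsym i j - x_i = t *: r], [t < 0] and [r = x_j - x_i], the two slopes of
    an affine function with linear part [L] are [L r / |r|] and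
    [t * L r / (- t * |r|)], which cancel. *)
Lemma detJ_affine u i j : in_P1 Omega (fe_fun u) -> det_nbr i j ->
  detJ u i j = 0.
Proof.
move=> /affine_closure[c [a uE]] /xsym_opposite[Fy [t t0 yE]].
have closP : closed (@macro_elem R d T i).
  by apply: compact_closed; [exact: norm_hausdorff|exact: macro_elem_compact].
pose L (x : 'rV[R]_d) := \sum_k a 0 k * x 0 k.
pose r : 'rV[R]_d := node_pos j - node_pos i.
have nodeE k : u k 0 = c + L (node_pos k).
  by rewrite -fe_fun_node uE//; apply: macro_elem_closure (node_in_macro_elem k).
have symE : usym u i j = c + L (xsym i j).
  by rewrite /usym uE//; apply: (@macro_elem_closure i); apply: closP; case: Fy.
have LD x y : L (x + y) = L x + L y.
  by rewrite /L -big_split/=; apply: eq_bigr => k _; rewrite mxE mulrDr.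
have LZ s x : L (s *: x) = s * L x.
  by rewrite /L big_distrr/=; apply: eq_bigr => k _; rewrite mxE mulrCA.
have jE : u j 0 - u i 0 = L r.
  by rewrite !nodeE -[node_pos j](subrK (node_pos i)) LD -/r; ring.
have yE' : usym u i j - u i 0 = t * L r.
  by rewrite symE nodeE yE LD LZ -/r; ring.
rewrite /detJ jE yE' -/r [in xsym i j - _]yE -/r [_ + t *: r]addrC addrK enormZ ltr0_norm//.
by rewrite mulNr invrN mulrN invfM mulrACA divff ?lt_eqF// mul1r subrr.
Qed.

Lemma alpha_affine q u i : 0 < q -> in_P1 Omega (fe_fun u) -> alpha q u i = 0.
Proof.
move=> q0 hu; rewrite /alpha; case: ifP => // _.
rewrite big1 => [|j ij]; last exact: detJ_affine.
by rewrite normr0 mul0r powR0// gt_eqF.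
Qed.

End Mesh.

(** * Linearity preservation *)

Theorem theorem4p5 (R : realType) (d : nat) (hd : d = 2%N \/ d = 3%N)
  (Omega : set 'rV[R]_d) (hOmega : bounded_domain Omega)
  (T : mesh R d) (hT : conforming_mesh_of T Omega)
  (f : R -> 'rV[R]_d) (hf : lipschitz f)
  (q : R) (hq : 0 < q)
  (u : 'cV[R]_(nnodes T)) (hu : in_P1 Omega (fe_fun u)) :
  [/\ forall i j, nu Omega f q u i j = 0,
      matK Omega f q u = matF Omega f u,
      matM Omega q u = massG T Omega,
      (* semi-discrete problem, at any time t with u_h(t) = u *)
      forall (g v : R -> 'cV[R]_(nnodes T)) (t : R), v t = u ->
        semi_discrete (matM Omega q) (matK Omega f q) g v t <->
        semi_discrete (fun=> massG T Omega) (matF Omega f) g v t &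
      (* discrete problem, with u_h^{n+1} = u *)
      forall (tn tn1 : R) (g1 un : 'cV[R]_(nnodes T)), tn < tn1 ->
        backward_euler (matM Omega q) (matK Omega f q) tn tn1 g1 un u <->
        backward_euler (fun=> massG T Omega) (matF Omega f) tn tn1 g1 un u].
Proof.
have alpha0 i : alpha q u i = 0 := alpha_affine hT q u i hq hu.
have nu_off0 i j : nu_off Omega f q u i j = 0.
  by rewrite /nu_off !alpha0 !mul0r !maxxx.
have nu0 i j : nu Omega f q u i j = 0.
  by rewrite /nu; case: ifP => // _; rewrite big1.
have KF : matK Omega f q u = matF Omega f u.
  rewrite /matK [X in _ + X](_ : _ = 0) ?addr0//.
  by apply/matrixP => i j; rewrite !mxE nu0 mul0r if_same.
have MG : matM Omega q u = massG T Omega.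
  by apply/matrixP => i j; rewrite !mxE alpha0 subr0 mul1r mul0r addr0.
split=> // [g v t vt|tn tn1 g1 un _].
- by rewrite /semi_discrete vt MG KF.
- by rewrite /backward_euler MG KF.
Qed.
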